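(* Let $A=(1,a_1,\ldots,a_k)$ be an orderly currency and let $2\leq m\leq k$ be such that $a_{m-1}>2a_{m-2}$ and $a_m>2a_{m-1}$. Then for every $t$ with $m\leq t\leq k-1$ we have $a_{t+1}-a_t\geq a_m-a_{m-1}$.
   Context: A currency is a finite sequence of integers $A=(a_0,a_1,\ldots,a_k)$ with $1=a_0<a_1<\cdots<a_k$. For an integer amount $c>0$, $\mathrm{opt}_A(c)$ is the minimum number of coins (values from $A$, repetitions allowed) summing to $c$, and $\mathrm{grd}_A(c)$ is the number of coins used by the greedy algorithm, which repeatedly takes the largest coin not exceeding the remaining amount. $A$ is orderly if $\mathrm{opt}_A(c)=\mathrm{grd}_A(c)$ for all integers $c>0$. *)

(* Defs.v *)
From mathcomp Require Import all_boot all_order zify.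
Set Implicit Arguments.
Unset Strict Implicit.
Unset Printing Implicit Defensive.

(* Coins are positive, so natural numbers lose nothing over integers. *)
Record currency := Currency {
  coins :> seq nat;
  head_coins : ohead coins = Some 1;
  sorted_coins : sorted ltn coins
}.

Definition coin (A : currency) (i : nat) : nat := nth 0 A i.

Lemma mem1_currency (A : currency) : 1 \in coins A.
Proof. by case: A => [[|a s] //= [->] _]; rewrite mem_head. Qed.

Lemma currency_gt0 (A : currency) a : a \in coins A -> 0 < a.
Proof.
case: A => [[|b s] //= [->] sorted_s]; rewrite inE => /orP[/eqP-> //|a_s].
by move/(order_path_min ltn_trans)/allP/(_ _ a_s): sorted_s => /ltnW.
Qed.

(* c is the value of some multiset of exactly n coins *)
Definition payable (A : currency) (c n : nat) : bool :=
  [exists s : n.-tuple (seq_sub (coins A)), sumn (map val s) == c].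

Lemma payableP (A : currency) c n :
  reflect (exists s : seq nat, [/\ size s = n, {subset s <= coins A} & sumn s = c])
          (payable A c n).
Proof.
apply: (iffP existsP) => [[s /eqP sum_s]|[s [size_s sub_s sum_s]]].
  exists (map val s); split=> //; first by rewrite size_map size_tuple.
  by move=> _ /mapP[x _ ->]; apply: valP.
have val_s : map val (pmap (insub : nat -> option (seq_sub (coins A))) s) = s.
  by rewrite pmap_filter; [apply/all_filterP/allP=> x /sub_s; rewrite isSome_insub|apply: insubK].
have size_t : size (pmap (insub : nat -> option (seq_sub (coins A))) s) == n.
  by rewrite -(size_map val) val_s size_s.
by exists (Tuple size_t); rewrite /= val_s sum_s.
Qed.

Lemma ex_payable (A : currency) c : exists n, payable A c n.
Proof.
exists c; apply/payableP; exists (nseq c 1).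
split; rewrite ?size_nseq ?sumn_nseq ?mul1n //.
by move=> x /nseqP[-> _]; apply: mem1_currency.
Qed.

Definition opt (A : currency) (c : nat) : nat := ex_minn (ex_payable A c).

Definition largest_coin (A : currency) (c : nat) : nat :=
  \max_(a <- coins A | a <= c) a.

(* Each greedy step lowers the remaining amount by at least 1, so c steps
   always exhaust the amount c; see grdE. *)
Fixpoint grd_rec (A : currency) (fuel c : nat) : nat :=
  if fuel is n.+1 then
    if c == 0 then 0 else (grd_rec A n (c - largest_coin A c)).+1
  else 0.

Definition grd (A : currency) (c : nat) : nat := grd_rec A c c.

Lemma largest_coinP (A : currency) c : 0 < c ->
  [/\ largest_coin A c \in coins A, largest_coin A c <= c &
      forall a, a \in coins A -> a <= c -> a <= largest_coin A c].
Proof.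
move=> c_gt0; have max_c a : a \in coins A -> a <= c -> a <= largest_coin A c.
  by move=> aA a_le_c; exact: (@leq_bigmax_seq _ (coins A) (fun b => b <= c) id a).
have: largest_coin A c = 0 \/
      largest_coin A c \in coins A /\ largest_coin A c <= c.
  rewrite /largest_coin big_seq_cond.
  elim/big_ind: _ => [|x y hx hy|a /andP[]]; [by left| |by right].
  by rewrite /maxn; case: ifP.
case=> [max0|[]]; last by split.
by have := max_c 1 (mem1_currency A) c_gt0; rewrite max0.
Qed.

Lemma grdE (A : currency) c :
  grd A c = if c == 0 then 0 else (grd A (c - largest_coin A c)).+1.
Proof.
have stable n m d : d <= n -> d <= m -> grd_rec A n d = grd_rec A m d.
  elim: n m d => [|n IHn] [|m] [|d] //= d_n d_m; congr _.+1.
  have [/currency_gt0 l_gt0 _ _] := largest_coinP A (ltn0Sn d).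
  by apply: IHn; lia.
rewrite /grd; case: c => //= c; congr _.+1.
have [/currency_gt0 l_gt0 _ _] := largest_coinP A (ltn0Sn c).
by apply: stable; lia.
Qed.

Definition orderly (A : currency) : Prop :=
  forall c : nat, 0 < c -> opt A c = grd A c.

(* Main.v *)
(** Write b = a_(m-1), M = a_m and d = M - b > b, and suppose that two coins
    that are at least M differ by less than d.  Only sums K + c of two coins are
    needed: greedy pays them with two coins, so if K1 is the largest coin not
    exceeding K + c, then K + c - K1 is 0 or a coin.
    Take the last gap g < d.  Adding M to its lower end shows that g <= b, and
    adding b shows that e = b - g is 0 or a coin, so e <= a_(m-2) < b / 2.
    Let y >= M be the least coin such that y + g is also a coin, and consider
    the last gap l < y - e.  If l < d, the same argument gives b - l <= a_(m-2)
    and also l <= e, which is absurd.  If d <= l, adding y and y + g to the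
    lower end of this gap shows that y - l and y - l + g are coins; minimality
    of y forces y - l + g <= b, so that y - l <= e, a contradiction. *)
Require Import Defs.
From mathcomp Require Import all_boot all_order zify.

Lemma grd_two_coins (A : currency) (x y : nat) : orderly A ->
  x \in coins A -> y \in coins A -> grd A (x + y) <= 2.
Proof.
move=> orderly_A xA yA; have x_gt0 := currency_gt0 xA.
rewrite -orderly_A; last by lia.
rewrite /opt; case: ex_minnP => n _; apply; apply/payableP.
exists [:: x; y]; split=> //=; last by rewrite addn0.
by move=> z; rewrite !inE => /orP[] /eqP ->.
Qed.

Lemma grd_le1 (A : currency) (c : nat) : grd A c <= 1 ->
  c = 0 \/ c \in coins A.
Proof.
rewrite grdE; case: eqP => [->|/eqP c_neq0]; first by left.
rewrite ltnS grdE; case: (_ - _ =P 0) => // c_le _; right.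
have [|lA l_le _] := largest_coinP A (c := c); first by lia.
by have -> : c = largest_coin A c by lia.
Qed.

(** Greedy pays [K + c] with at most two coins and takes [K1] first, so at most one coin remains. *)
Lemma two_coins_floor (A : currency) (K K1 c : nat) : orderly A ->
  K \in coins A -> c \in coins A -> K1 \in coins A -> K1 <= K + c ->
  (forall a, a \in coins A -> a <= K + c -> a <= K1) ->
  K + c - K1 = 0 \/ K + c - K1 \in coins A.
Proof.
move=> orderly_A KA cA K1A K1_le K1_max; apply: grd_le1.
have K_gt0 := currency_gt0 KA.
have [|lA l_le l_max] := largest_coinP A (c := K + c); first by lia.
have K1E : K1 = largest_coin A (K + c).
  by apply/eqP; rewrite eqn_leq l_max // K1_max.
have := grd_two_coins _ _ _ orderly_A KA cA.
by rewrite grdE -K1E; case: eqP => [|_]; lia.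
Qed.

(** Take [L1] maximal: a coin strictly between [L1] and [L1 + theta] would be a larger choice, with
    [L1] as its lower end. *)
Lemma last_gap (A : currency) (M theta K K1 : nat) :
  K \in coins A -> K1 \in coins A -> M <= K -> K < K1 < K + theta ->
  exists L L1, [/\ L \in coins A, L1 \in coins A, M <= L, L < L1 < L + theta &
    forall a, a \in coins A -> a <= L1 \/ L1 + theta <= a].
Proof.
move=> KA K1A M_le K_K1.
pose P L1 := (L1 \in coins A) &&
  has (fun L => (M <= L) && (L < L1 < L + theta)) (coins A).
have exP : exists n, P n.
  by exists K1; rewrite /P K1A; apply/hasP; exists K; rewrite // M_le.
have ubP n : P n -> n <= \max_(a <- coins A) a.
  by case/andP=> nA _; exact: (@leq_bigmax_seq _ (coins A) xpredT id n).
case: (ex_maxnP exP ubP) => L1 /andP[L1A /hasP[L LA /andP[M_L L_L1]]] L1_max.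
exists L, L1; split=> // a aA; case: (leqP a L1) => [|L1_a]; first by left.
right; rewrite leqNgt; apply/negP => a_lt.
suff /L1_max: P a by lia.
by rewrite /P aA; apply/hasP; exists L1 => //; lia.
Qed.

Section GapBound.

Variables (A : currency) (f b M : nat).
Hypotheses (orderly_A : orderly A) (bA : b \in coins A) (MA : M \in coins A).
Hypotheses (f_b : 2 * f < b) (b_M : 2 * b < M).
Hypothesis gap_fb : forall a, a \in coins A -> a <= f \/ b <= a.
Hypothesis gap_bM : forall a, a \in coins A -> a <= b \/ M <= a.

Lemma last_gap_bound (theta K K1 : nat) :
  K \in coins A -> K1 \in coins A -> K < K1 -> K1 - K < M - b ->
  M - b <= theta ->
  (forall a, a \in coins A -> a <= K1 \/ K1 + theta <= a) ->
  [/\ K1 - K + theta <= M, K1 - K <= b & b - (K1 - K) <= f].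
Proof.
move=> KA K1A K_K1 gap_lt le_theta K1_last.
have sum_le : K1 - K + theta <= M.
  rewrite leqNgt; apply/negP => M_lt.
  (* The remainder [M - (K1 - K)] would lie strictly between [b] and [M]. *)
  have [|||/gap_bM] := two_coins_floor _ _ _ _ orderly_A KA MA K1A; try lia.
  by move=> a /K1_last; lia.
have le_b : K1 - K <= b by lia.
split=> //.
have [|||/gap_fb] := two_coins_floor _ _ _ _ orderly_A KA bA K1A; try lia.
by move=> a /K1_last; lia.
Qed.

Lemma gap_bound (K K1 : nat) :
  K \in coins A -> K1 \in coins A -> M <= K -> K < K1 -> M - b <= K1 - K.
Proof.
move=> KA K1A M_K K_K1; rewrite leqNgt; apply/negP => gap_lt.
have [|Y [Y1 [YA Y1A M_Y Y_Y1 Y1_last]]] :=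
  last_gap _ M (M - b) _ _ KA K1A M_K; first by lia.
have [|||_ g_le e_le] := last_gap_bound _ _ _ YA Y1A _ _ _ Y1_last; try lia.
have YgE : Y + (Y1 - Y) = Y1 by lia.
move: (Y1 - Y) YgE g_le e_le => g YgE g_le e_le.
have exF : exists y, [&& y \in coins A, M <= y & y + g \in coins A].
  by exists Y; rewrite YA M_Y YgE.
case: (ex_minnP exF) => y /and3P[yA M_y ygA] y_min.
clear K K1 KA K1A M_K K_K1 gap_lt Y Y1 YA Y1A M_Y Y_Y1 Y1_last YgE exF.
have [|L [L1 [LA L1A M_L /andP[L_L1 gap_L] L1_last]]] :=
  last_gap _ M (y - (b - g)) _ _ yA ygA M_y; first by lia.
have [gap_lt|gap_ge] := ltnP (L1 - L) (M - b).
  have le_theta : M - b <= y - (b - g) by lia.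
  (* With l = [L1 - L], both l and b - l are at most f, against 2f < b. *)
  by have [] := last_gap_bound _ _ _ LA L1A L_L1 gap_lt le_theta L1_last; lia.
have [|||xA] := two_coins_floor _ _ _ _ orderly_A LA yA L1A; try lia.
  by move=> a /L1_last; lia.
(* [L1] is still the largest coin that fits, since L1 - L >= M - b > b = (b - g) + g. *)
have [|||xgA] := two_coins_floor _ _ _ _ orderly_A LA ygA L1A; try lia.
  by move=> a /L1_last; lia.
have xgE : L + (y + g) - L1 = L + y - L1 + g by lia.
rewrite xgE in xgA.
have x_b : L + y - L1 <= b.
  case: (gap_bM _ xA) => // M_x.
  by have := y_min (L + y - L1); rewrite xA M_x xgA => /(_ isT); lia.
(* Here x + g <= 2b < M, where x = y - (L1 - L), so x <= b - g. *)
by have [] := gap_bM _ xgA; lia.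
Qed.

End GapBound.

Lemma coin_gap (A : currency) (i a : nat) : i.+1 < size A ->
  a \in coins A -> a <= coin A i \/ coin A i.+1 <= a.
Proof.
move=> i_lt /(nthP 0)[j j_lt <-].
have mono := sorted_ltn_nth ltn_trans 0 (sorted_coins A).
case: (ltngtP j i) => [ji|ij|->]; last by left.
  by left; apply/ltnW/mono; rewrite ?inE //; lia.
right; case: (ltngtP i.+1 j) => [ij'|ji|<-] //; last by lia.
by apply/ltnW/mono; rewrite ?inE.
Qed.

Theorem theorem5p6 (A : currency) (k m : nat)
  (size_A : size A = k.+1)
  (orderly_A : orderly A)
  (m_bounds : 2 <= m <= k)
  (gap_m1 : coin A (m - 1) > 2 * coin A (m - 2))
  (gap_m : coin A m > 2 * coin A (m - 1)) :
  forall t : nat, m <= t <= k - 1 ->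
    coin A t.+1 - coin A t >= coin A m - coin A (m - 1).
Proof.
move=> t t_bounds.
have mem i : i <= k -> coin A i \in coins A.
  by move=> i_le; rewrite mem_nth // size_A ltnS.
have mono i j : i < j <= k -> coin A i < coin A j.
  move=> ij; apply: (sorted_ltn_nth ltn_trans 0 (sorted_coins A));
  by rewrite ?inE; lia.
apply: (@gap_bound A (coin A (m - 2))) => //; try (apply: mem; lia).
- move=> a aA; have -> : m - 1 = (m - 2).+1 by lia.
  by apply: coin_gap => //; lia.
- move=> a aA; have {2}-> : m = (m - 1).+1 by lia.
  by apply: coin_gap => //; lia.
- case: (ltngtP m t) => [mt|tm|->] //; last by lia.
  by apply/ltnW/mono; lia.
- by apply: mono; lia.
Qed.
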